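(* Let $n\ge 2$ and $a\in\mathbb{R}$. If $u\in C^2(\mathbb{R}^n_+)$ satisfies $\operatorname{div}(y_n^a\nabla u)=0$ on $\mathbb{R}^n_+$, then for every $x\in\partial\mathbb{R}^n_+$ and every $\lambda>0$ the function $u_{x,\lambda}$ satisfies the same equation, i.e. $\operatorname{div}(y_n^a\nabla u_{x,\lambda})=0$ on $\mathbb{R}^n_+$.
   Context: $\mathbb{R}^n_+=\{y=(y',y_n)\in\mathbb{R}^n: y_n>0\}$ is the open upper half space and $\partial\mathbb{R}^n_+=\{y_n=0\}$. For $x\in\partial\mathbb{R}^n_+$ and $\lambda>0$, put $y^{x,\lambda}=x+\frac{\lambda^2(y-x)}{|y-x|^2}$ and $u_{x,\lambda}(y)=\frac{\lambda^{n-2+a}}{|y-x|^{n-2+a}}\,u(y^{x,\lambda})$. *)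

(* Defs.v *)
From mathcomp Require Import all_boot all_order all_algebra.
From mathcomp Require Import all_classical all_reals all_analysis.
Set Implicit Arguments.
Unset Strict Implicit.
Unset Printing Implicit Defensive.
Import Order.TTheory GRing.Theory Num.Theory.
Import numFieldNormedType.Exports.
Local Open Scope classical_set_scope.
Local Open Scope ring_scope.

(* Points of R^N are row vectors 'rV[R]_N with N = n.+1, so that the last
   coordinate y_N is [y 0 ord_max]. *)

Definition upper_half_space (R : realType) (n : nat) : set 'rV[R]_n.+1 :=
  [set y | 0 < y 0 ord_max].

Definition half_space_boundary (R : realType) (n : nat) : set 'rV[R]_n.+1 :=
  [set y | y 0 ord_max = 0].

(* The library norm on 'rV[R]_N is the sup norm, hence an explicit Euclidean
   norm. *)
Definition enorm (R : realType) (N : nat) (v : 'rV[R]_N) : R :=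
  Num.sqrt (\sum_i v 0 i ^+ 2).

Definition evec (R : realType) (n : nat) (i : 'I_n.+1) : 'rV[R]_n.+1 :=
  delta_mx 0 i.

Definition partial (R : realType) (n : nat) (i : 'I_n.+1)
  (f : 'rV[R]_n.+1 -> R) : 'rV[R]_n.+1 -> R := 'D_(evec R i) f.

Definition grad (R : realType) (n : nat) (f : 'rV[R]_n.+1 -> R)
  (y : 'rV[R]_n.+1) : 'rV[R]_n.+1 := \row_i partial i f y.

Definition divergence (R : realType) (n : nat)
  (F : 'rV[R]_n.+1 -> 'rV[R]_n.+1) (y : 'rV[R]_n.+1) : R :=
  \sum_i partial i (fun z => F z 0 i) y.

(* Meant for an open set D; f may take arbitrary values outside D. *)
Definition C2_on (R : realType) (n : nat) (D : set 'rV[R]_n.+1)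
  (f : 'rV[R]_n.+1 -> R) : Prop :=
  forall y, D y ->
    [/\ {for y, continuous f},
        (forall i, derivable f y (evec R i) /\
                   {for y, continuous (partial i f)}) &
        (forall i j, derivable (partial i f) y (evec R j) /\
                     {for y, continuous (partial j (partial i f))})].

Definition weighted_grad (R : realType) (n : nat) (a : R)
  (u : 'rV[R]_n.+1 -> R) (y : 'rV[R]_n.+1) : 'rV[R]_n.+1 :=
  (y 0 ord_max `^ a) *: grad u y.

(* 'D_v is total, with a default value where the limit does not exist, so the
   equation div (y_N^a grad u) = 0 is stated together with the existence of
   every derivative it involves. *)
Definition weighted_harmonic (R : realType) (n : nat) (a : R)
  (u : 'rV[R]_n.+1 -> R) : Prop :=
  forall y, upper_half_space y ->
    [/\ (forall i, derivable u y (evec R i)),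
        (forall i, derivable (fun z => weighted_grad a u z 0 i) y (evec R i)) &
        divergence (weighted_grad a u) y = 0].

Definition inversion (R : realType) (n : nat) (x : 'rV[R]_n.+1) (lam : R)
  (y : 'rV[R]_n.+1) : 'rV[R]_n.+1 :=
  x + (lam ^+ 2 / enorm (y - x) ^+ 2) *: (y - x).

Definition kelvin (R : realType) (n : nat) (a : R) (x : 'rV[R]_n.+1) (lam : R)
  (u : 'rV[R]_n.+1 -> R) (y : 'rV[R]_n.+1) : R :=
  let p := n.+1%:R - 2 + a in
  (lam `^ p) / (enorm (y - x) `^ p) * u (inversion x lam y).

(* Main.v *)
Require Import Defs.
From HB Require Import structures.
From mathcomp Require Import all_boot all_order all_algebra.
From mathcomp Require Import all_classical all_reals all_analysis.
From mathcomp Require Import ring.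
Import Order.TTheory GRing.Theory Num.Theory.
Import numFieldNormedType.Exports.
Local Open Scope classical_set_scope.
Local Open Scope ring_scope.

(** Put [z = y - x], [s = |z|^2], [l = lam^2], [p = N - 2 + a], [q = - p / 2]
    where [N] is the dimension, and let [I y = x + (l / s) z] be the inversion.
    Up to the constant [lam^p], the Kelvin transform is [s^q u(I y)], and
    [div (y_N^a grad v) = y_N^a (Laplacian v + (a / y_N) d_N v)], so the claim
    is a pointwise identity between second derivatives.

    The Jacobian of [I] is [l / s] times the reflection [1 - 2 z z^T / s].
    Hence [d_i (f o I) = (l / s) (d_i f) o I - (2 l / s^2) z_i E_f], where
    [E_f = sum_j z_j (d_j f) o I] is the derivative of [f] at [I y] along [z].
    Applying this rule to [u], and then again to the partial derivatives
    of [u], gives ([kelvin_laplacian])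

      Laplacian (s^q u o I)
        = (s^q / s) (- 2 a q u + (2 a l / s) E_u + (l^2 / s) Laplacian u),

    with [u], [E_u] and the Laplacian of [u] taken at [I y].  The second
    derivatives of [u] along [z] cancel because [I] is conformal, and the
    choice of [p] is what makes the coefficients of [u] and [E_u] multiples
    of [a].  Since [x_N = 0] gives [z_N = y_N], the term [(a / y_N) d_N]
    contributes exactly the opposite of the first two summands, plus
    [(s^q / s) (a l / y_N) d_N u].  What remains is [s^q l^2 / s^2] times
    [Laplacian u + (a / w_N) d_N u] at [w = I y], because [w_N = (l / s) y_N];
    this vanishes by the equation for [u].

    The analytic input is the chain rule for [f o I], where only the partial
    derivatives of [f] are known to exist: continuity of the partial
    derivatives gives Frechet differentiability
    ([continuous_partials_differentiable]).  It is applied to [u] and to each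
    partial derivative of [u]. *)

Set Implicit Arguments.
Unset Strict Implicit.
Unset Printing Implicit Defensive.

(** * Functions with continuous partial derivatives *)

(** Directional derivatives reduce to derivatives of functions of one real
    variable, where derivability and differentiability agree. *)
Lemma is_derive_lineP (R : realType) (V W : normedModType R) (f : V -> W)
    (z v : V) (t : R) (d : W) :
  is_derive (t *: v + z) v f d <-> is_derive t 1 (fun s => f (s *: v + z)) d.
Proof.
have E : (fun h : R => h^-1 *: ((f \o shift (t *: v + z)) (h *: v)
                               - f (t *: v + z))) =
    (fun h : R => h^-1 *: (((fun s => f (s *: v + z)) \o shift t) (h *: 1)
                               - f (t *: v + z))).
  by apply/funext => h /=; rewrite [h *: 1]mulr1 scalerDl addrA.
by split=> -[fd <-]; (split; [move: fd|]); rewrite /derivable /derive E.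
Qed.

Lemma is_derive_diff_comp (R : realType) (V V' W : normedModType R)
    (f : V' -> W) (g : V -> V') (y v : V) (dg : V') :
  differentiable f (g y) -> is_derive y v g dg ->
  is_derive y v (f \o g) ('d f (g y) dg).
Proof.
move=> df dg'.
have y0 : 0 *: v + y = y by rewrite scale0r add0r.
have : is_derive (0 *: v + y) v g dg by rewrite y0.
move=> /is_derive_lineP; set c := (fun s => _) => -[/derivable1_diffP dc dgE].
have c0 : c 0 = g y by rewrite /c y0.
suff H : is_derive (0 : R) 1 (f \o c) ('d f (g y) dg).
  by rewrite -y0; apply/is_derive_lineP; rewrite /= y0.
have dfc : differentiable f (c 0) by rewrite c0.
split; first exact/derivable1_diffP/differentiable_comp.
rewrite deriveE; last exact: differentiable_comp.
by rewrite diff_comp //= c0 -dgE deriveE.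
Qed.

(** The mean value theorem along a segment; the bound is on the deviation from
    a fixed slope [L] because [L] will be the partial derivative at the centre
    of a ball while the segment lies anywhere in that ball. *)
Lemma mean_value_estimate (R : realType) (V : normedModType R) (f : V -> R)
    (z v : V) (s L e : R) :
  (forall t : R, `|t| <= `|s| ->
     derivable f (t *: v + z) v /\ `|'D_v f (t *: v + z) - L| <= e) ->
  `|f (s *: v + z) - f z - s * L| <= e * `|s|.
Proof.
move=> fe; pose g t := f (t *: v + z).
have dg (t : R) : `|t| <= `|s| -> is_derive t 1 g ('D_v f (t *: v + z)).
  by move=> /fe[fd _]; exact: (is_derive_lineP f z v t _).1 (DeriveDef fd erefl).
have cg (t : R) : `|t| <= `|s| -> {for t, continuous g}.
  by move=> /dg[gd _]; exact/differentiable_continuous/derivable1_diffP.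
have g0 : g 0 = f z by rewrite /g scale0r add0r.
have MVTg (a b : R) : a <= b ->
    (forall t : R, t \in `[a, b] -> `|t| <= `|s|) ->
    exists2 c, c \in `[a, b] & g b - g a = 'D_v f (c *: v + z) * (b - a).
  move=> ab abs; apply: MVT_segment => // [t tab|].
    by apply: dg; apply: abs; exact: subset_itv_oo_cc tab.
  apply: continuous_in_subspaceT => t; rewrite inE/= => tab.
  by apply: cg; exact: abs.
have [c cs gE] : exists2 c, `|c| <= `|s| &
    g s - g 0 = 'D_v f (c *: v + z) * s.
  have [s0|s0] := leP 0 s.
    have abs t : t \in `[0, s] -> `|t| <= `|s|.
      by rewrite in_itv/= => /andP[t0 ts]; rewrite !ger0_norm.
    have [c cs gE] := MVTg 0 s s0 abs.
    by exists c; [exact: abs|rewrite gE subr0].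
  have abs t : t \in `[s, 0] -> `|t| <= `|s|.
    rewrite in_itv/= => /andP[ts t0].
    by rewrite (ler0_norm t0) (ler0_norm (ltW s0)) lerN2.
  have [c cs gE] := MVTg s 0 (ltW s0) abs.
  exists c; first exact: abs.
  by rewrite -[LHS]opprB gE sub0r mulrN opprK.
rewrite -/(g s) -g0 gE mulrC -mulrBr normrM mulrC ler_wpM2r //.
by have [_] := fe c cs.
Qed.

Lemma row_norm_mono (R : realType) (n : nat) (v w : 'rV[R]_n) :
  (forall i, `|v 0 i| <= `|w 0 i|) -> `|v| <= `|w|.
Proof.
move=> vw; rewrite /Num.Def.normr/= !mx_normrE.
apply: le_bigmax2 => -[i j] _ /=.
by rewrite !(ord1 i).
Qed.

(** The increment [h] is built up one coordinate at a time: each step moves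
    along a basis vector, so that the mean value estimate applies, and it stays
    in the ball because the norm is monotone in each coordinate. *)
Lemma first_order_estimate (R : realType) (n : nat) (f : 'rV[R]_n.+1 -> R)
    (y : 'rV[R]_n.+1) (L : 'I_n.+1 -> R) (r e : R) :
  0 <= e ->
  (forall z, `|z - y| < r ->
     forall i, derivable f z (evec R i) /\ `|partial i f z - L i| <= e) ->
  forall h, `|h| < r ->
    `|f (h + y) - f y - \sum_i h 0 i * L i| <= n.+1%:R * e * `|h|.
Proof.
move=> e0 fL.
(* Induction on the number [m] of leading coordinates of [h] that may be
   nonzero. *)
suff H m : forall h : 'rV[R]_n.+1, `|h| < r ->
    (forall k : 'I_n.+1, (m <= k)%N -> h 0 k = 0) ->
    `|f (h + y) - f y - \sum_i h 0 i * L i| <= m%:R * e * `|h|.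
  by move=> h hr; apply: H => // k; rewrite leqNgt ltn_ord.
elim: m => [|m IH] h hr hm.
  have -> : h = 0 by apply/rowP => k; rewrite mxE hm.
  rewrite add0r subrr sub0r big1 ?oppr0 ?normr0 ?mulr0// => i _.
  by rewrite mxE mul0r.
have [mn|nm] := ltnP m n.+1; last first.
  apply: le_trans (IH h hr _) _.
    by move=> k mk; have := ltn_ord k; rewrite ltnNge (leq_trans nm mk).
  by rewrite ler_wpM2r // ler_wpM2r // ler_nat.
pose k := Ordinal mn.
pose w := \row_i (if i == k then 0 else h 0 i).
have hE : h = h 0 k *: evec R k + w.
  apply/rowP => i; rewrite !mxE eqxx /=.
  by have [->|ik] := eqVneq i k; rewrite ?mulr1 ?addr0 ?mulr0 ?add0r.
have wh : `|w| <= `|h|.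
  apply: row_norm_mono => i; rewrite mxE.
  by case: ifP => // _; rewrite normr0.
have sumE : \sum_i h 0 i * L i = h 0 k * L k + \sum_i w 0 i * L i.
  rewrite (bigD1 k)//= (bigD1 k (F := fun i => w 0 i * L i))//=.
  rewrite mxE eqxx mul0r add0r; congr (_ + _).
  by apply: eq_bigr => i /negPf ik; rewrite mxE ik.
have step1 : `|f (w + y) - f y - \sum_i w 0 i * L i| <= m%:R * e * `|h|.
  apply: le_trans (IH w (le_lt_trans wh hr) _) _.
    move=> i; rewrite leq_eqVlt => /orP[/eqP mi|mi]; rewrite mxE.
      by rewrite (_ : i = k) ?eqxx//; exact: val_inj.
    by case: ifP => // _; exact: hm.
  by rewrite ler_wpM2l // mulr_ge0.
have step2 : `|f (h + y) - f (w + y) - h 0 k * L k| <= e * `|h|.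
  have -> : h + y = h 0 k *: evec R k + (w + y) by rewrite addrA -hE.
  apply: (@le_trans _ _ (e * `|h 0 k|)).
    apply: mean_value_estimate => t tk.
    apply: fL; rewrite addrA addrK; apply: le_lt_trans hr.
    apply: row_norm_mono => i; rewrite !mxE eqxx /=.
    by have [->|ik] := eqVneq i k; rewrite ?mulr1 ?addr0 ?mulr0 ?add0r.
  rewrite ler_wpM2l //.
  by rewrite /Num.Def.normr/= mx_normrE (le_bigmax _ (fun ij => `|h ij.1 ij.2|) (0, k)).
rewrite sumE.
have -> : f (h + y) - f y - (h 0 k * L k + \sum_i w 0 i * L i) =
  (f (w + y) - f y - \sum_i w 0 i * L i) +
  (f (h + y) - f (w + y) - h 0 k * L k) by ring.
apply: le_trans (ler_normD _ _) _.
apply: le_trans (lerD step1 step2) _.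
by rewrite -natr1 !mulrDl mul1r.
Qed.

(** The candidate differential; it is a constant so that it can carry the
    structure of a linear map, which the differential requires. *)
Definition row_form (R : realType) (n : nat) (L : 'I_n -> R) (h : 'rV[R]_n) : R :=
  \sum_i h 0 i * L i.

Lemma row_form_is_linear (R : realType) (n : nat) (L : 'I_n -> R) :
  linear (row_form L).
Proof.
move=> c v w; rewrite /row_form scaler_sumr -big_split/=.
by apply: eq_bigr => i _; rewrite !mxE mulrDl -mulrA.
Qed.

HB.instance Definition _ (R : realType) (n : nat) (L : 'I_n -> R) :=
  GRing.isLinear.Build R 'rV[R]_n R _ (row_form L) (row_form_is_linear L).

Lemma continuous_row_form (R : realType) (n : nat) (L : 'I_n -> R) :
  continuous (row_form L).
Proof.
move=> v; rewrite /row_form.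
apply: (@continuous_big R 'I_n +%R 0 xpredT _ _ _ (fun i (w : 'rV[R]_n) => w 0 i * L i)) => [|i _ w].
  exact: add_continuous.

by apply: cvgMl; [exact: (nbhs_filter w)|exact: coord_continuous].
Qed.

(** The differential is defined by a choice among the linear maps satisfying a
    little-o expansion; this restates its existence and its value as an
    inequality with an explicit slope. *)
Lemma differentiable_of_estimate (R : realType) (V W : normedModType R)
    (f : V -> W) (df : {linear V -> W}) (x : V) :
  continuous df ->
  (forall e, 0 < e ->
     \forall h \near 0, `|f (h + x) - f x - df h| <= e * `|h|) ->
  differentiable f x /\ 'd f x = df :> (V -> W).
Proof.
move=> dfc fe.
have fE : f \o shift x = cst (f x) + df +o_ 0 id.
  apply/eqaddoP => e e0; apply: filterS (fe e e0) => h.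
  by rewrite !fctE /= opprD addrA.
have dE := diff_unique dfc fE.
by split=> //; apply/diff_locallyP; rewrite dE.
Qed.

(** Near [y] every partial derivative is within [e / N] of its value at [y], so
    that the [N] steps of the first-order estimate add up to [e |h|]. *)
Lemma continuous_partials_differentiable (R : realType) (n : nat)
    (f : 'rV[R]_n.+1 -> R) (y : 'rV[R]_n.+1) :
  (\forall z \near y, forall i, derivable f z (evec R i)) ->
  (forall i, {for y, continuous (partial i f)}) ->
  differentiable f y /\
  'd f y = row_form (fun i => partial i f y) :> ('rV[R]_n.+1 -> R).
Proof.
move=> fd fc.
set L := fun i => partial i f y.
have cL := @continuous_row_form R n.+1 L.
apply: (@differentiable_of_estimate R 'rV[R]_n.+1 R f (row_form L)) => // e e_gt0.
  have e'0 : 0 < e / n.+1%:R by rewrite divr_gt0.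
  have : \forall z \near y, forall i,
      derivable f z (evec R i) /\ `|partial i f z - L i| <= e / n.+1%:R.
    have fc' : \forall z \near y, forall i,
        `|partial i f z - L i| <= e / n.+1%:R.
      apply: (@filter_forall _ _ _ (nbhs y) (nbhs_filter y)) => i.
      have /cvgrPdist_le/(_ _ e'0) := fc i.
      by apply: filterS => z; rewrite distrC.
    by apply: filterS2 fd fc' => z zd zL i; split.
  move=> /nbhs_normP[r /= r0 yr].
  have : \forall h \near (0 : 'rV[R]_n.+1), `|h| < r.
    by apply/nbhs_normP; exists r => //= h; rewrite /ball_/= sub0r normrN.
  apply: filterS => h hr.
  have := @first_order_estimate R n f y L r (e / n.+1%:R) (ltW e'0) _ h hr.
  rewrite mulrCA divff ?pnatr_eq0// mulr1 /=.
  apply => z zy; apply: yr; by rewrite /ball_/= distrC.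
Qed.

Definition C1_at (R : realType) (n : nat) (f : 'rV[R]_n.+1 -> R)
    (w : 'rV[R]_n.+1) : Prop :=
  (\forall z \near w, forall i, derivable f z (evec R i)) /\
  (forall i, {for w, continuous (partial i f)}).

Lemma is_derive_partials_comp (R : realType) (n : nat)
    (f : 'rV[R]_n.+1 -> R) (M : 'rV[R]_n.+1 -> 'rV[R]_n.+1)
    (y v : 'rV[R]_n.+1) (J : 'I_n.+1 -> R) :
  C1_at f (M y) ->
  (forall j, is_derive y v (fun z => M z 0 j) (J j)) ->
  is_derive y v (fun z => f (M z)) (\sum_j J j * partial j f (M y)).
Proof.
move=> [fd fc] MJ.
have [df dfE] := continuous_partials_differentiable fd fc.
have Md : derivable M y v.
  by apply/derivable_mxP => i j; rewrite (ord1 i); have [] := MJ j.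
have MJ' : is_derive y v M (\row_j J j).
  split=> //; rewrite derive_mx //; apply/rowP => j; rewrite !mxE.
  by have [_ ->] := MJ j.
apply: is_derive_eq (is_derive_diff_comp df MJ') _.
by rewrite dfE /row_form; apply: eq_bigr => j _; rewrite mxE.
Qed.

(** * Rules for directional derivatives *)

(** The rules below repeat those for sums and products with the functions in
    pointwise form, so that they compose by unification. *)
Lemma is_derive_mul (R : realType) (V : normedModType R) (f g : V -> R)
    (y v : V) (df dg : R) :
  is_derive y v f df -> is_derive y v g dg ->
  is_derive y v (fun z => f z * g z) (df * g y + f y * dg).
Proof.
move=> Hf Hg; apply: is_derive_eq (is_deriveM Hf Hg) _.
by rewrite /GRing.scale/= addrC (mulrC df).
Qed.

Lemma is_derive_add (R : realType) (V : normedModType R) (f g : V -> R)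
    (y v : V) (df dg : R) :
  is_derive y v f df -> is_derive y v g dg ->
  is_derive y v (fun z => f z + g z) (df + dg).
Proof. exact: is_deriveD. Qed.

Lemma is_derive_bigsum (R : realType) (V : normedModType R) (n : nat)
    (f : 'I_n -> V -> R) (y v : V) (df : 'I_n -> R) :
  (forall i, is_derive y v (f i) (df i)) ->
  is_derive y v (fun z => \sum_i f i z) (\sum_i df i).
Proof.
by move=> Hf; rewrite -fct_sumE; exact: is_derive_sum.
Qed.

Lemma is_derive_cmul (R : realType) (V : normedModType R) (c : R) (f : V -> R)
    (y v : V) (df : R) :
  is_derive y v f df -> is_derive y v (fun z => c * f z) (c * df).
Proof. exact: is_deriveZ. Qed.

Lemma is_derive_powR (R : realType) (V : normedModType R) (f : V -> R)
    (y v : V) (df q : R) :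
  0 < f y -> is_derive y v f df ->
  is_derive y v (fun z => f z `^ q) (q * f y `^ (q - 1) * df).
Proof.
move=> fy Hf.
have [dp pE] := is_derive1_powR q fy.
have dpow : differentiable (fun t : R => t `^ q) (f y) by apply/derivable1_diffP.
apply: is_derive_eq (is_derive_diff_comp dpow Hf) _.
by rewrite deriv1E // derive1E pE /GRing.scale/= mulrC.
Qed.

Lemma powR_sub_nat (R : realType) (s q : R) (k : nat) :
  0 < s -> s `^ (q - k%:R) = s `^ q / s ^+ k.
Proof.
move=> s0; rewrite powRB; last by rewrite (gt_eqF s0) implybT.
by rewrite powR_mulrn// ltW.
Qed.

Lemma is_derive_coord (R : realType) (n : nat) (y : 'rV[R]_n.+1)
    (i j : 'I_n.+1) :
  is_derive y (evec R i) (fun z => z 0 j) (i == j)%:R.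
Proof.
have H := is_derive_id y (evec R i).
have [d1 d2] := H; split; first by move/derivable_mxP : d1; exact.
have := derive_mx d1; rewrite d2 => /matrixP/(_ 0 j).
by rewrite !mxE eqxx /= eq_sym => <-.
Qed.

Lemma is_derive_subcoord (R : realType) (n : nat) (x y : 'rV[R]_n.+1)
    (i j : 'I_n.+1) :
  is_derive y (evec R i) (fun w => (w - x) 0 j) (i == j)%:R.
Proof.
have -> : (fun w : 'rV[R]_n.+1 => (w - x) 0 j) = (fun w => w 0 j + - x 0 j).
  by apply/funext => w; rewrite !mxE.
apply: is_derive_eq (is_derive_add (is_derive_coord y i j) (is_derive_cst _ _ _)) _.
by rewrite addr0.
Qed.

(** * The half space and the weighted divergence *)

Lemma near_upper_half_space (R : realType) (n : nat) (y : 'rV[R]_n.+1) :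
  upper_half_space y -> \forall z \near y, upper_half_space z.
Proof.
move=> y0.
have := @coord_continuous R 1 n.+1 0 ord_max y.
by move=> /(_ [set t | 0 < t]); apply; exact: lt_nbhsr.
Qed.

Lemma C2_on_C1_at (R : realType) (n : nat) (u : 'rV[R]_n.+1 -> R)
    (w : 'rV[R]_n.+1) :
  C2_on (@upper_half_space R n) u -> upper_half_space w ->
  C1_at u w /\ forall j, C1_at (partial j u) w.
Proof.
move=> uC2 w0; have nw := near_upper_half_space w0.
split=> [|j]; split.
- by apply: filterS nw => z /uC2[_ + _] i => /(_ i)[].
- by move=> i; have [_ /(_ i)[]] := uC2 _ w0.
- by apply: filterS nw => z /uC2[_ _ +] i => /(_ j i)[].
- by move=> i; have [_ _ /(_ j i)[]] := uC2 _ w0.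
Qed.

(** [div (y_N^a grad f) = y_N^a (Laplacian f + (a / y_N) d_N f)].  The partial
    derivatives are only given by a formula [G] near [y], since the formulas
    for the Kelvin transform hold on the half space alone. *)
Lemma divergence_weighted_grad (R : realType) (n : nat) (a : R)
    (f : 'rV[R]_n.+1 -> R) (y : 'rV[R]_n.+1)
    (G : 'I_n.+1 -> 'rV[R]_n.+1 -> R) (D : 'I_n.+1 -> R) :
  upper_half_space y ->
  (forall i, \forall w \near y, partial i f w = G i w) ->
  (forall i, is_derive y (evec R i) (G i) (D i)) ->
  (forall i, derivable (fun w => weighted_grad a f w 0 i) y (evec R i)) /\
  divergence (weighted_grad a f) y =
    y 0 ord_max `^ a * (\sum_i D i + a / y 0 ord_max * G ord_max y).
Proof.
move=> y0 fG GD.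
have dW i : is_derive y (evec R i) (fun w => weighted_grad a f w 0 i)
    ((i == ord_max)%:R * (a * (y 0 ord_max `^ a / y 0 ord_max)) * G i y
     + y 0 ord_max `^ a * D i).
  apply: (@near_eq_is_derive R 'rV[R]_n.+1 R (fun w => w 0 ord_max `^ a * G i w)).
    by apply: filterS (fG i) => w E; rewrite !mxE E.
  apply: is_derive_eq (is_derive_mul (is_derive_powR a y0
    (is_derive_coord y i ord_max)) (GD i)) _.
  rewrite (powR_sub_nat a 1 y0) expr1; ring.
split=> [i|]; first by have [] := dW i.
rewrite /divergence /partial.
under eq_bigr => i _ do rewrite (@derive_val _ _ _ _ _ _ _ (dW i)).
rewrite big_split/= (bigD1 ord_max)//= eqxx mul1r big1 => [|i /negPf ->].
  by rewrite -mulr_sumr; ring.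
by rewrite !mul0r.
Qed.

(** * Derivatives of the inversion *)

Definition sqdist (R : realType) (n : nat) (x y : 'rV[R]_n) : R :=
  \sum_i (y - x) 0 i ^+ 2.

Lemma sqdist_gt0 (R : realType) (n : nat) (x y : 'rV[R]_n.+1) :
  half_space_boundary x -> upper_half_space y -> 0 < sqdist x y.
Proof.
rewrite /half_space_boundary /upper_half_space/= => x0 y0.
rewrite /sqdist (bigD1 ord_max)//= ltr_pwDl//.
  by rewrite !mxE x0 subr0 exprn_gt0.
by apply: sumr_ge0 => i _; exact: sqr_ge0.
Qed.

Lemma sqr_enorm (R : realType) (n : nat) (x y : 'rV[R]_n) :
  enorm (y - x) ^+ 2 = sqdist x y.
Proof. by rewrite sqr_sqrtr// sumr_ge0// => i _; exact: sqr_ge0. Qed.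

Lemma inversion_coord (R : realType) (n : nat) (x y : 'rV[R]_n.+1) (lam : R)
    (j : 'I_n.+1) :
  inversion x lam y 0 j = x 0 j + lam ^+ 2 / sqdist x y * (y - x) 0 j.
Proof. by rewrite /inversion sqr_enorm !mxE. Qed.

Lemma inversion_upper_half_space (R : realType) (n : nat)
    (x y : 'rV[R]_n.+1) (lam : R) :
  half_space_boundary x -> 0 < lam -> upper_half_space y ->
  upper_half_space (inversion x lam y).
Proof.
move=> xb lam0 yu; have s0 := sqdist_gt0 xb yu.
rewrite /upper_half_space/= inversion_coord !mxE xb subr0 add0r.
by rewrite mulr_gt0// divr_gt0// exprn_gt0.
Qed.

Lemma is_derive_sqdist (R : realType) (n : nat) (x y : 'rV[R]_n.+1)
    (i : 'I_n.+1) :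
  is_derive y (evec R i) (sqdist x) (2 * (y - x) 0 i).
Proof.
apply: is_derive_eq (is_derive_bigsum (fun j =>
  is_derive_mul (is_derive_subcoord x y i j) (is_derive_subcoord x y i j))) _.
rewrite (bigD1 i)//= big1 => [|j /negPf ji]; last first.
  by rewrite eq_sym ji mul0r mulr0 addr0.
by rewrite eqxx mul1r mulr1; ring.
Qed.

Lemma is_derive_sqdist_powR (R : realType) (n : nat) (x y : 'rV[R]_n.+1)
    (i : 'I_n.+1) (q : R) :
  0 < sqdist x y ->
  is_derive y (evec R i) (fun w => sqdist x w `^ q)
    (2 * q * (y - x) 0 i * (sqdist x y `^ q / sqdist x y)).
Proof.
move=> s0; apply: is_derive_eq (is_derive_powR q s0 (is_derive_sqdist x y i)) _.
by rewrite (powR_sub_nat q 1 s0) expr1; ring.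
Qed.

(** The derivative of [f] at the inverted point, in the direction [y - x] of the
    uninverted one: it is what the rank-one part of the Jacobian of the
    inversion produces. *)
Definition radial_partial (R : realType) (n : nat) (x : 'rV[R]_n.+1) (lam : R)
    (f : 'rV[R]_n.+1 -> R) (y : 'rV[R]_n.+1) : R :=
  \sum_j (y - x) 0 j * partial j f (inversion x lam y).

(** The Jacobian of the inversion is [lam^2 / s] times the reflection in the
    hyperplane orthogonal to [y - x], with [s = |y - x|^2]; the two terms come
    from the identity and from the rank-one part of that reflection. *)
Lemma is_derive_comp_inversion (R : realType) (n : nat) (x y : 'rV[R]_n.+1)
    (lam : R) (i : 'I_n.+1) (f : 'rV[R]_n.+1 -> R) :
  0 < sqdist x y -> C1_at f (inversion x lam y) ->
  is_derive y (evec R i) (fun w => f (inversion x lam w))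
    (lam ^+ 2 / sqdist x y * partial i f (inversion x lam y) -
     2 * lam ^+ 2 / sqdist x y ^+ 2 * (y - x) 0 i * radial_partial x lam f y).
Proof.
move=> s0 fC1; set s := sqdist x y; have sN0 : s != 0 by rewrite gt_eqF.
pose J j := lam ^+ 2 / s * (i == j)%:R -
  2 * lam ^+ 2 / s ^+ 2 * (y - x) 0 i * (y - x) 0 j.
have IJ j : is_derive y (evec R i) (fun w => inversion x lam w 0 j) (J j).
  have -> : (fun w => inversion x lam w 0 j) =
      (fun w => x 0 j + lam ^+ 2 * (sqdist x w `^ (- 1) * (w - x) 0 j)).
    apply/funext => w; rewrite inversion_coord powR_inv1; first by rewrite mulrA.
    by rewrite -sqr_enorm sqr_ge0.
  apply: is_derive_eq (is_derive_add (is_derive_cst _ _ _) (is_derive_cmul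
    (lam ^+ 2) (is_derive_mul (is_derive_sqdist_powR i (- 1) s0)
                  (is_derive_subcoord x y i j)))) _.
  rewrite powR_inv1 ?(ltW s0)// -/s /J; field.
  exact: sN0.
apply: is_derive_eq (is_derive_partials_comp fC1 IJ) _.
set P := fun j => partial j f (inversion x lam y).
have -> : \sum_j J j * P j = lam ^+ 2 / s * (\sum_j (i == j)%:R * P j) -
    2 * lam ^+ 2 / s ^+ 2 * (y - x) 0 i * (\sum_j (y - x) 0 j * P j).
  by rewrite !mulr_sumr -sumrB; apply: eq_bigr => j _; rewrite /J; ring.
rewrite (bigD1 i)//= eqxx mul1r big1 ?addr0// => j /negPf ji.
by rewrite eq_sym ji mul0r.
Qed.

(** * The Laplacian of the Kelvin transform *)

(** Both factors of [z_j (d_j f)(I y)] depend on [y]: the first summand comes from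
    [z_j], the others from the chain rule applied to [d_j f]. *)
Lemma is_derive_radial_partial (R : realType) (n : nat) (x y : 'rV[R]_n.+1)
    (lam : R) (i : 'I_n.+1) (f : 'rV[R]_n.+1 -> R) :
  0 < sqdist x y -> (forall j, C1_at (partial j f) (inversion x lam y)) ->
  is_derive y (evec R i) (radial_partial x lam f)
    (partial i f (inversion x lam y)
     + lam ^+ 2 / sqdist x y *
         (\sum_j (y - x) 0 j * partial i (partial j f) (inversion x lam y))
     - 2 * lam ^+ 2 / sqdist x y ^+ 2 * (y - x) 0 i *
         (\sum_j (y - x) 0 j * radial_partial x lam (partial j f) y)).
Proof.
move=> s0 fC1.
apply: is_derive_eq (is_derive_bigsum (fun j => is_derive_mul
  (is_derive_subcoord x y i j) (is_derive_comp_inversion i s0 (fC1 j)))) _.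
rewrite big_split/= (bigD1 i)//= eqxx mul1r big1 ?addr0 => [|j /negPf ji].
  by rewrite -addrA !mulr_sumr -sumrB; congr (_ + _); apply: eq_bigr => j _; ring.
by rewrite eq_sym ji mul0r.
Qed.

(** The partial derivatives of [s^q (u o I)], with the powers of [s] left
    unreduced: the product rule is to be applied to them once more. *)
Definition kelvin_partial (R : realType) (n : nat) (q : R)
    (x : 'rV[R]_n.+1) (lam : R) (u : 'rV[R]_n.+1 -> R) (i : 'I_n.+1)
    (y : 'rV[R]_n.+1) : R :=
  2 * q * ((y - x) 0 i * (sqdist x y `^ (q - 1) * u (inversion x lam y)))
  + lam ^+ 2 * (sqdist x y `^ (q - 1) * partial i u (inversion x lam y))
  + - (2 * lam ^+ 2) *
      ((y - x) 0 i * (sqdist x y `^ (q - 2) * radial_partial x lam u y)).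

Lemma is_derive_kelvin (R : realType) (n : nat) (q : R)
    (x y : 'rV[R]_n.+1) (lam : R) (u : 'rV[R]_n.+1 -> R) (i : 'I_n.+1) :
  0 < sqdist x y -> C1_at u (inversion x lam y) ->
  is_derive y (evec R i) (fun w => sqdist x w `^ q * u (inversion x lam w))
    (kelvin_partial q x lam u i y).
Proof.
move=> s0 uC1; apply: is_derive_eq (is_derive_mul
  (is_derive_sqdist_powR i q s0) (is_derive_comp_inversion i s0 uC1)) _.
rewrite /kelvin_partial (powR_sub_nat q 1 s0) (powR_sub_nat q 2 s0).
by field; rewrite gt_eqF.
Qed.

(** Grouped by the dependence on [i]: summed over [i], the five groups of
    terms become multiples of [N], of [s], of the derivative [E] of [u] along [z],
    of its Laplacian, and of its second derivative [Q] along [z]. *)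
Lemma is_derive_kelvin_partial (R : realType) (n : nat) (q : R)
    (x y : 'rV[R]_n.+1) (lam : R) (u : 'rV[R]_n.+1 -> R) (i : 'I_n.+1) :
  let w := inversion x lam y in let z := (y - x) 0 in
  let s := sqdist x y in let B := s `^ q in let l := lam ^+ 2 in
  let E := radial_partial x lam u y in
  let F := fun j => radial_partial x lam (partial j u) y in
  let H := \sum_j z j * partial i (partial j u) w in
  let Q := \sum_j z j * F j in
  0 < s -> C1_at u w -> (forall j, C1_at (partial j u) w) ->
  is_derive y (evec R i) (kelvin_partial q x lam u i)
    ((2 * q * B / s * u w - 2 * l * B / s ^+ 2 * E)
     + (4 * q * (q - 1) * B / s ^+ 2 * u w - 4 * (2 * q - 2) * l * B / s ^+ 3 * E
        + 4 * l ^+ 2 * B / s ^+ 4 * Q) * z i ^+ 2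
     + (4 * q - 4) * l * B / s ^+ 2 * (z i * partial i u w)
     + l ^+ 2 * B / s ^+ 2 * partial i (partial i u) w
     - 2 * l ^+ 2 * B / s ^+ 3 * (z i * F i)
     - 2 * l ^+ 2 * B / s ^+ 3 * (z i * H)).
Proof.
move=> w z s B l E F H Q s0 uC1 duC1.
have dz := is_derive_subcoord x y i i.
have du := is_derive_comp_inversion i s0 uC1.
have ddu := is_derive_comp_inversion i s0 (duC1 i).
have dE := is_derive_radial_partial i s0 duC1.
have dA := is_derive_sqdist_powR i _ s0.
apply: is_derive_eq (is_derive_add (is_derive_add
  (is_derive_cmul (2 * q) (is_derive_mul dz (is_derive_mul (dA (q - 1)) du)))
  (is_derive_cmul l (is_derive_mul (dA (q - 1)) ddu)))
  (is_derive_cmul (- (2 * l)) (is_derive_mul dz (is_derive_mul (dA (q - 2)) dE)))) _.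
rewrite eqxx (powR_sub_nat q 1 s0) (powR_sub_nat q 2 s0).
rewrite -/s -/w -/z -/B -/l -/E -/H.
rewrite -[radial_partial x lam (partial i u) y]/(F i).
rewrite -[\sum_j z j * radial_partial x lam (partial j u) y]/Q.
rewrite !(mulr1n, mul1r).
field.
by rewrite gt_eqF.
Qed.

Lemma sum_lincomb (R : realType) (I : finType) (c0 c1 c2 c3 c4 : R)
    (f1 f2 f3 f4 f5 : I -> R) :
  \sum_i (c0 + c1 * f1 i + c2 * f2 i + c3 * f3 i - c4 * f4 i - c4 * f5 i) =
  #|I|%:R * c0 + c1 * (\sum_i f1 i) + c2 * (\sum_i f2 i) + c3 * (\sum_i f3 i)
  - c4 * (\sum_i f4 i) - c4 * (\sum_i f5 i).
Proof.
by rewrite sumrB sumrB !big_split/= sumr_const mulr_natl !mulr_sumr.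
Qed.

(** The second derivative [Q] along [z] drops out: it enters with coefficient
    [4 l^2 s^q / s^4] times [sum_i z_i^2 = s], and twice with
    [- 2 l^2 s^q / s^3].  The value of [q] turns [N + 2 q - 2] into [- a], which
    leaves a multiple of [a] in front of both terms of order below two. *)
Lemma kelvin_laplacian (R : realType) (n : nat) (a : R)
    (x y : 'rV[R]_n.+1) (lam : R) (u : 'rV[R]_n.+1 -> R) :
  let w := inversion x lam y in let s := sqdist x y in
  let q := - ((n.+1%:R - 2 + a) / 2) in
  0 < s -> C1_at u w -> (forall j, C1_at (partial j u) w) ->
  exists D : 'I_n.+1 -> R,
    (forall i, is_derive y (evec R i) (kelvin_partial q x lam u i) (D i)) /\
    \sum_i D i = s `^ q / s *
      (- (2 * a * q * u w) + 2 * a * lam ^+ 2 / s * radial_partial x lam u y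
       + lam ^+ 4 / s * \sum_i partial i (partial i u) w).
Proof.
move=> w s q s0 uC1 duC1.
pose z := (y - x) 0; pose E := radial_partial x lam u y.
pose l := lam ^+ 2; pose B := s `^ q.
pose F i := radial_partial x lam (partial i u) y.
pose H i := \sum_j z j * partial i (partial j u) w.
pose Q := \sum_j z j * F j.
pose T := \sum_i partial i (partial i u) w.
pose c0 := 2 * q * B / s * u w - 2 * l * B / s ^+ 2 * E.
pose c1 := 4 * q * (q - 1) * B / s ^+ 2 * u w
  - 4 * (2 * q - 2) * l * B / s ^+ 3 * E + 4 * l ^+ 2 * B / s ^+ 4 * Q.
pose c2 := (4 * q - 4) * l * B / s ^+ 2.
pose c3 := l ^+ 2 * B / s ^+ 2.
pose c4 := 2 * l ^+ 2 * B / s ^+ 3.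
exists (fun i => c0 + c1 * z i ^+ 2 + c2 * (z i * partial i u w)
  + c3 * partial i (partial i u) w - c4 * (z i * F i) - c4 * (z i * H i)).
split; first by move=> i; exact: is_derive_kelvin_partial.
transitivity (n.+1%:R * c0 + c1 * s + c2 * E + c3 * T - c4 * Q - c4 * Q).
  (* [H] contracts the inner derivative with [z] and [F] the outer one; contracted
     twice, both are the same double sum. *)
  have HQ : \sum_i z i * H i = Q.
    under eq_bigr do rewrite mulr_sumr.
    rewrite exchange_big/=; apply: eq_bigr => j _.
    by rewrite mulr_sumr; apply: eq_bigr => i _; rewrite mulrCA.
  rewrite sum_lincomb card_ord.
  exact: (congr1 (fun t => _ - c4 * t) HQ).
rewrite /c0 /c1 /c2 /c3 /c4 -/E -/T -/B /l /q.
by field; rewrite gt_eqF.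
Qed.

Lemma kelvin_powR_sqdist (R : realType) (n : nat) (a : R) (x y : 'rV[R]_n.+1)
    (lam : R) (u : 'rV[R]_n.+1 -> R) :
  kelvin a x lam u y = lam `^ (n.+1%:R - 2 + a) *
    (sqdist x y `^ (- ((n.+1%:R - 2 + a) / 2)) * u (inversion x lam y)).
Proof.
have s0 : 0 <= sqdist x y by rewrite -sqr_enorm sqr_ge0.
rewrite /kelvin /=.
have -> : enorm (y - x) = sqdist x y `^ 2^-1 by rewrite powR12_sqrt.
by rewrite mulrA powRN -powRrM (mulrC 2^-1).
Qed.

(** * Invariance of the equation *)

Unset Implicit Arguments.

Theorem lemma2p1 (R : realType) (n : nat) (hn : (2 <= n.+1)%N) (a : R)
  (u : 'rV[R]_n.+1 -> R)
  (hC2 : C2_on (@upper_half_space R n) u)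
  (hu : weighted_harmonic a u)
  (x : 'rV[R]_n.+1) (hx : half_space_boundary x)
  (lam : R) (hlam : 0 < lam) :
  weighted_harmonic a (kelvin a x lam u).
Proof.
set q := - ((n.+1%:R - 2 + a) / 2).
set C := lam `^ (n.+1%:R - 2 + a).
have kE : kelvin a x lam u =
    fun w => C * (sqdist x w `^ q * u (inversion x lam w)).
  by apply/funext => w; exact: kelvin_powR_sqdist.
have dk y i : upper_half_space y ->
    is_derive y (evec R i) (kelvin a x lam u) (C * kelvin_partial q x lam u i y).
  move=> y0; rewrite kE; apply: is_derive_cmul; apply: is_derive_kelvin.
    exact: sqdist_gt0.
  by have [] := C2_on_C1_at hC2 (inversion_upper_half_space hx hlam y0).
move=> y y0.
have s0 := sqdist_gt0 hx y0; set s := sqdist x y in s0.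
have w0 := inversion_upper_half_space hx hlam y0.
set w := inversion x lam y in w0.
have [uC1 duC1] := C2_on_C1_at hC2 w0.
have [D [dD sumD]] := kelvin_laplacian a s0 uC1 duC1.
have near_k i : \forall v \near y, partial i (kelvin a x lam u) v =
    C * kelvin_partial q x lam u i v.
  by apply: filterS (near_upper_half_space y0) => v v0; have [] := dk v i v0.
have [dW divE] := divergence_weighted_grad a y0 near_k
  (fun i => is_derive_cmul C (dD i)).
split => [i||]; [by have [] := dk y i y0|exact: dW|].
rewrite divE -mulr_sumr sumD.
have eq_u : \sum_i partial i (partial i u) w
    + a / w 0 ord_max * partial ord_max u w = 0.
  (* The divergence form of the equation for [u], expanded at [w]. *)
  have near_u i : \forall v \near w, partial i u v = partial i u v.
    by apply: filterS (near_upper_half_space w0).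
  have ddu i : is_derive w (evec R i) (partial i u) (partial i (partial i u) w).
    by have [_ _ /(_ i i)[d _]] := hC2 _ w0; split.
  have [_ divu] := divergence_weighted_grad a w0 near_u ddu.
  have [_ _] := hu _ w0; rewrite divu => /eqP.
  rewrite mulf_eq0 => /orP[|/eqP//].
  by rewrite gt_eqF// powR_gt0.
have yn : (y - x) 0 ord_max = y 0 ord_max by rewrite !mxE hx subr0.
have wn : w 0 ord_max = lam ^+ 2 / s * y 0 ord_max.
  by rewrite /w inversion_coord hx add0r yn.
have TE : \sum_i partial i (partial i u) w =
    - (a / w 0 ord_max * partial ord_max u w).
  by apply/eqP; rewrite -addr_eq0 eq_u.
rewrite TE wn /kelvin_partial yn -/w -/s.
rewrite (powR_sub_nat q 1 s0) (powR_sub_nat q 2 s0) -/q.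
have yN0 : y 0 ord_max != 0 by rewrite gt_eqF.
field.
by rewrite yN0 !gt_eqF.
Qed.
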